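(* The operator ideal $\mathscr{WCG}$ of weakly compactly generated operators is surjective, but not injective.
   Context: Operators are bounded linear maps between Banach spaces; $\mathscr{B}(E,F)$ denotes the operators $E\to F$. A Banach space is weakly compactly generated (WCG) if it contains a weakly compact subset whose linear span is dense. $\mathscr{WCG}(E,F)$ is the set of $T\in\mathscr{B}(E,F)$ for which there is a closed subspace $Z$ of $F$ that is a WCG Banach space and satisfies $T(E)\subseteq Z$; $\mathscr{WCG}$ is the class of all such operators. An operator ideal $\mathscr{J}$ is surjective if, for all Banach spaces $E,E_0,F$, every surjective $Q\in\mathscr{B}(E,E_0)$ and every $T\in\mathscr{B}(E_0,F)$, $TQ\in\mathscr{J}(E,F)$ implies $T\in\mathscr{J}(E_0,F)$. It is injective if, for all Banach spaces $E,F$, every closed subspace $F_0$ of $F$ with inclusion map $\iota\colon F_0\to F$ and every $T\in\mathscr{B}(E,F_0)$, $\iota T\in\mathscr{J}(E,F)$ implies $T\in\mathscr{J}(E,F_0)$. *)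

(* Defs.v *)
From HB Require Import structures.
From mathcomp Require Import all_boot all_order all_algebra.
From mathcomp Require Import complex.
From mathcomp Require Import all_classical all_reals all_analysis.

Set Implicit Arguments.
Unset Strict Implicit.
Unset Printing Implicit Defensive.

Import Order.TTheory GRing.Theory Num.Theory.
Import numFieldNormedType.Exports.

Local Open Scope classical_set_scope.
Local Open Scope ring_scope.

(* numFieldType is the library's base for normed modules and also covers fields
   such as rat; this cuts it down to the real and the complex numbers. *)
Inductive real_or_complex (R : realType) : numFieldType -> Prop :=
| Real_scalars : real_or_complex R R
| Complex_scalars : real_or_complex R R[i].

Section BoundedOperators.
Context {K : numFieldType}.

Definition bounded_operator (E F : normedModType K) : set {linear E -> F} :=
  [set T | exists M : K, forall x, `|T x| <= M * `|x|].

Definition dual (E : normedModType K) : Type :=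
  {f : {linear E -> K^o} | bounded_operator f}.

(* The carrier of E with its weak topology, i.e. the coarsest topology that
   makes every element of the dual continuous. *)
Definition weak_space (E : normedModType K) : Type :=
  sup_topology (fun f : dual E => Topological.on (initial_topology (sval f))).

HB.instance Definition _ (E : normedModType K) :=
  Topological.copy (weak_space E)
    (sup_topology
       (fun f : dual E => Topological.on (initial_topology (sval f)))).

Definition weakly_compact (E : normedModType K) (A : set E) : Prop :=
  compact (A : set (weak_space E)).

Definition linear_span (V : lmodType K) (A : set V) : set V :=
  [set x | exists n (c : 'I_n -> K) (v : 'I_n -> V),
     (forall i, A (v i)) /\ x = \sum_(i < n) c i *: v i].

Definition WCG_space (E : completeNormedModType K) : Prop :=
  exists A : set E, weakly_compact A /\ dense (linear_span A).

End BoundedOperators.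

Section ClosedSubspace.
Context {K : numFieldType} {F : completeNormedModType K}.

Record closed_subspace := ClosedSubspace {
  csub_set :> set F;
  csub_submod : GRing.submod_closed [in csub_set];
  csub_closed : closed csub_set
}.

Definition csub_pred (Z : closed_subspace) : {pred F} :=
  fun x => x \in csub_set Z.

Lemma csub_pred_submod (Z : closed_subspace) :
  GRing.submod_closed (csub_pred Z).
Proof. exact: csub_submod. Qed.

HB.instance Definition _ (Z : closed_subspace) :=
  GRing.isSubmodClosed.Build K F (csub_pred Z) (csub_pred_submod Z).

End ClosedSubspace.
Arguments closed_subspace {K} F.

Section SubspaceType.
Context {K : numFieldType} {F : completeNormedModType K}.
Variable Z : closed_subspace F.

(* The closed subspace Z as a Banach space of its own, with the norm of F. *)
Record csub := CSub { csub_val : F; csub_valP : csub_val \in csub_pred Z }.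

HB.instance Definition _ := [isSub for csub_val].
HB.instance Definition _ := [Choice of csub by <:].
HB.instance Definition _ := [SubChoice_isSubLmodule of csub by <:].

Definition csub_norm (x : csub) : K := `|\val x|.

Lemma csub_normD x y : csub_norm (x + y) <= csub_norm x + csub_norm y.
Proof. by rewrite /csub_norm raddfD ler_normD. Qed.

Lemma csub_normZ (a : K) x : csub_norm (a *: x) = `|a| * csub_norm x.
Proof. by rewrite /csub_norm linearZ normrZ. Qed.

Lemma csub_norm0_eq0 x : csub_norm x = 0 -> x = 0.
Proof. by move=> /normr0_eq0 x0; apply/val_inj; rewrite x0 raddf0. Qed.

HB.instance Definition _ :=
  Lmodule_isNormed.Build K csub csub_normD csub_normZ csub_norm0_eq0.

Lemma csub_complete (G : set_system csub) :
  ProperFilter G -> cauchy G -> cvg G.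
Proof.
move=> GG /cauchy_ballP Gc.
have ballE e (x y : csub) : ball x e y = ball (\val x) e (\val y).
  rewrite -!ball_normE /ball_/=.
  by rewrite [in RHS](_ : csub_val x - csub_val y = \val (x - y)) ?raddfB.
have /cauchy_cvg vGc : cauchy (\val @ G).
  apply/cauchy_ballP => e e0; have := Gc _ e0.
  rewrite !near_simpl; case=> -[A B] [GA GB] AB.
  exists (\val @` A, \val @` B) => /=.
    by split; [apply: filterS GA|apply: filterS GB] => x ?; exists x.
  move=> [_ _] [/= [x Ax <-] [y By <-]].
  by have := AB (x, y) (conj Ax By); rewrite /= ballE.
have /set_mem/= Zl : lim (\val @ G) \in csub_set Z.
  apply/mem_set; apply: (closed_cvg _ (@csub_closed _ _ Z)) vGc.
  by apply: nearW => x; exact/set_mem/csub_valP.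
apply/cvg_ex; exists (CSub (mem_set Zl)).
apply/cvgrPdist_lt => e e0.
by have /cvgrPdist_lt/(_ e e0) := vGc; apply: filterS.
Qed.

HB.instance Definition _ := Uniform_isComplete.Build csub csub_complete.

End SubspaceType.

Section OperatorIdeals.
Context {K : numFieldType}.

Definition inclusion (F : completeNormedModType K) (Z : closed_subspace F) :
  {linear csub Z -> F} := \val.

Definition operator_class : Type :=
  forall E F : completeNormedModType K, set {linear E -> F}.

(* An operator ideal in the sense of Pietsch. *)
Record operator_ideal (J : operator_class) : Prop := {
  ideal_bounded : forall E F, J E F `<=` @bounded_operator K E F;
  ideal_finite_rank : forall (E F : completeNormedModType K)
    (T : {linear E -> F}) (n : nat) (y : 'I_n -> F),
    bounded_operator T -> range T `<=` linear_span (range y) -> J E F T;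
  ideal_add : forall (E F : completeNormedModType K) (S T : {linear E -> F}),
    J E F S -> J E F T -> J E F (S \+ T : {linear E -> F});
  ideal_scale : forall (E F : completeNormedModType K) (a : K)
    (T : {linear E -> F}),
    J E F T -> J E F (a \*: T : {linear E -> F});
  ideal_comp : forall (D E F G : completeNormedModType K)
    (S : {linear D -> E}) (T : {linear E -> F}) (U : {linear F -> G}),
    bounded_operator S -> J E F T -> bounded_operator U ->
    J D G (U \o T \o S : {linear D -> G})
}.

Definition surjective_class (J : operator_class) : Prop :=
  forall (E E0 F : completeNormedModType K)
    (Q : {linear E -> E0}) (T : {linear E0 -> F}),
  bounded_operator Q -> range Q = [set: E0] -> bounded_operator T ->
  J E F (T \o Q : {linear E -> F}) -> J E0 F T.

Definition injective_class (J : operator_class) : Prop :=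
  forall (E F : completeNormedModType K) (F0 : closed_subspace F)
    (T : {linear E -> csub F0}),
  bounded_operator T ->
  J E F (inclusion F0 \o T : {linear E -> F}) -> J E (csub F0) T.

Definition WCG : operator_class := fun E F =>
  [set T | bounded_operator T /\
     exists Z : closed_subspace F, WCG_space (csub Z) /\ range T `<=` Z].

End OperatorIdeals.
Arguments operator_class K : clear implicits.
Arguments WCG K : clear implicits.

(* Main.v *)
Require Import Defs.
From mathcomp Require Import all_boot all_order all_algebra.
From mathcomp Require Import all_classical all_reals all_analysis.
From HB Require Import structures.
From mathcomp Require Import complex ring.

(* Surjectivity is immediate since [T] and [T \o Q] have the same range, and for
   the ideal properties the closed span of the images of the weakly compact
   generating sets is again WCG. Injectivity fails because a closed subspace of
   a WCG space need not be WCG (Rosenthal); the example here is as follows.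

   Let G = nat -> nat, and let e(n, g), for n in nat and g in G, be the function
   on partial selections l (at most one g for each level n) that is 1 if l
   selects g at level n and 0 otherwise. In the space of bounded functions on
   the selections, the closed span Z of all e(n, g) is essentially the l_1-sum
   over n of copies of c_0(G). It is WCG: 0 together with all e(n, g) / (n + 1)
   is weakly compact. Let X be the closed subspace of those x in Z whose
   coordinates satisfy x(g m, g) = 2 x(g (m + 1), g) for all g and m.

   By a gliding hump argument (the Schur property of l_1), for a weakly compact
   A in Z the coordinates x(n, g) tend to 0 as n grows, uniformly in g and in x
   in A. Choose N m beyond which they are less than 4^-m on A, and g strictly
   increasing with g m >= N m. The vector sum_m 2^-m e(g m, g) lies in X, so if
   A were contained in X and generated it, some x in A would have
   x(g m, g) = c 2^-m with c <> 0, contradicting |x(g m, g)| < 4^-m. *)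

Set Implicit Arguments.
Unset Strict Implicit.
Unset Printing Implicit Defensive.

Import Order.TTheory GRing.Theory Num.Theory.
Import numFieldNormedType.Exports.

Local Open Scope classical_set_scope.
Local Open Scope ring_scope.

(** * Order and completeness of the real and complex scalars *)

(** The common interface through which the counterexample is built once for both fields. Suprema are
    limited to nonnegative sets because the order of the complex numbers is partial. *)
Record scalar_facts (K : numFieldType) : Prop := {
  scalar_lub : forall (A : set K) (M : K), A !=set0 ->
    (forall a, A a -> 0 <= a <= M) ->
    exists s, (forall a, A a -> a <= s) /\
              (forall b, (forall a, A a -> a <= b) -> s <= b);
  scalar_archi : forall x : K, 0 <= x -> exists n : nat, x < n%:R;
  scalar_complete : forall G : set_system K,
    ProperFilter G ->
    (forall e, 0 < e -> exists z, G [set w | `|z - w| < e]) ->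
    exists l, forall e, 0 < e -> G [set w | `|l - w| < e]
}.

Lemma archi_lt (K : numFieldType) (HK : scalar_facts K) (x e : K) :
  0 <= x -> 0 < e ->
  exists n : nat, forall m, (n <= m)%N -> x / m.+1%:R < e.
Proof.
move=> x0 e0; have [n xn] := scalar_archi HK (divr_ge0 x0 (ltW e0)).
exists n => m nm; rewrite ltr_pdivrMr// mulrC -ltr_pdivrMr//.
by rewrite (lt_le_trans xn)// ler_nat ltnW.
Qed.

Lemma real_scalar_facts (R : realType) : scalar_facts R.
Proof.
split=> [A M A0 AM|x _|G GG Gc].
- have hA : has_sup A by split=> //; exists M => a /AM/andP[].
  exists (sup A); split=> [a Aa|b bA]; first exact: ub_le_sup hA.2 _ Aa.
  exact: ge_sup.
- by exists (Num.truncn x).+1; exact: truncnS_gt.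
- have /cauchy_cvg/cvg_ex[l Gl] : cauchy (G : set_system R).
    apply: cauchy_exP => e /Gc[z Gz]; exists z; by rewrite -ball_normE.
  by exists l => e e0; move/cvgrPdist_lt: Gl; exact.
Qed.


Lemma normc_ge_Im (R : rcfType) (x : R[i]) : `|complex.Im x|%:C%C <= `|x|.
Proof.
by case: x => a b; rewrite normc_def lecR -sqrtr_sqr ler_wsqrtr ?lerDr ?sqr_ge0.
Qed.

Lemma normc_le_ReIm (R : rcfType) (x : R[i]) :
  `|x| <= (`|complex.Re x| + `|complex.Im x|)%:C%C.
Proof.
case: x => a b; rewrite normc_def lecR /=.
rewrite -(ler_pXn2r (n := 2)) ?nnegrE ?sqrtr_ge0 ?addr_ge0 //.
rewrite sqr_sqrtr ?addr_ge0 ?sqr_ge0 // sqrrD !real_normK ?num_real//.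
by rewrite lerD2r lerDl mulrn_wge0 ?mulr_ge0.
Qed.

(** Nonnegative complex numbers are real, so the order properties are read off real parts; a Cauchy
    filter converges because its real and imaginary parts do. *)
Lemma complex_scalar_facts (R : realType) : scalar_facts R[i].
Proof.
have [_ archiR completeR] := real_scalar_facts R.
have real_of (a : R[i]) : 0 <= a -> a = (complex.Re a)%:C%C.
  by move=> a0; rewrite RRe_real ?ger0_real.
have Re_le (a b : R[i]) : a <= b -> complex.Re a <= complex.Re b.
  by rewrite lecE => /andP[].
split=> [A M A0 AM|x x0|G GG Gc].
- have hA : has_sup (@complex.Re R @` A).
    split; first by case: A0 => a Aa; exists (complex.Re a), a.
    exists (complex.Re M) => _ [a Aa <-]; have /andP[a0 aM] := AM _ Aa.
    exact: Re_le.
  exists (sup (@complex.Re R @` A))%:C%C; split=> [a Aa|b bA].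
    have /andP[a0 _] := AM _ Aa.
    by rewrite (real_of a)// lecR; apply: ub_le_sup hA.2 _ _; exists a.
  case: A0 => a0 Aa0; have b0 : 0 <= b.
    by apply: le_trans (bA _ Aa0); case/andP: (AM _ Aa0).
  rewrite (real_of b)// lecR; apply: ge_sup; first exact: hA.1.
  move=> _ [a Aa <-]; have /andP[a1 _] := AM _ Aa.
  exact/Re_le/bA.
- have [n xn] := archiR (complex.Re x) ltac:(by rewrite -lecR -real_of).
  by exists n; rewrite (real_of x)// -(rmorph_nat (real_complex R)) ltcR.
- have part_cvg (p : {additive R[i] -> R}) :
      (forall z, `|p z|%:C%C <= `|z|) ->
      exists l, forall e, 0 < e -> G [set w | `|l - p w| < e].
    move=> ple; apply: (completeR (p @ G)) => e e0.
    have [|z Gz] := Gc e%:C%C; first by rewrite ltcR.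
    exists (p z); apply: (@filterS _ G _ _ _ _ Gz) => w /= zw.
    have -> : p z - p w = p (z - w) by rewrite raddfB.
    by rewrite -ltcR (le_lt_trans (ple _)).
  have [a Ga] := part_cvg (@complex.Re R : {additive R[i] -> R})
    (@normc_ge_Re _).
  have [b Gb] := part_cvg (@complex.Im R : {additive R[i] -> R})
    (@normc_ge_Im _).
  exists (a +i* b)%C => e e0.
  have eE := real_of _ (ltW e0).
  have r0 : 0 < complex.Re e / 2 by rewrite divr_gt0// -ltcR -eE.
  apply: filterS (filterI (Ga _ r0) (Gb _ r0)) => -[x y] /= [ax by_].
  apply: le_lt_trans (normc_le_ReIm _) _.
  by rewrite eE ltcR [ltRHS]splitr ltrD.
Qed.

Lemma real_or_complex_facts (R : realType) (K : numFieldType) :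
  real_or_complex R K -> scalar_facts K.
Proof.
by case; [exact: real_scalar_facts|exact: complex_scalar_facts].
Qed.

(** * Norm estimates, bounded operators and the weak topology *)

Section NormedModules.
Context {K : numFieldType}.

Lemma closure_normP (V : normedModType K) (A : set V) p :
  closure A p <-> forall e, 0 < e -> exists a, A a /\ `|p - a| < e.
Proof.
split=> [clA e e0|clA B /nbhs_ballP[e /= e0 eB]].
  by have [a [Aa]] := clA _ (nbhsx_ballx p e e0); rewrite -ball_normE; exists a.
have [a [Aa pa]] := clA _ e0; exists a; split=> //.
by apply: eB; rewrite -ball_normE.
Qed.

(** A bound [M] is an arbitrary scalar when [E] is trivial; a positive one can be divided by. *)
Lemma bounded_operator_pos (E F : normedModType K) (T : {linear E -> F}) :
  bounded_operator T -> exists2 M, 0 < M & forall x, `|T x| <= M * `|x|.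
Proof.
move=> [M TM]; exists (`|M| + 1) => [|x]; first by rewrite ltr_wpDl.
have Mx0 : 0 <= M * `|x| := le_trans (normr_ge0 _) (TM x).
rewrite (le_trans (TM x))// -[leLHS]ger0_norm// normrM normr_id.
by rewrite mulrDl lerDl mul1r.
Qed.

Lemma closure_image (E F : normedModType K) (T : {linear E -> F}) A p :
  bounded_operator T -> closure A p -> closure (T @` A) (T p).
Proof.
move=> /bounded_operator_pos[M M0 TM] /closure_normP clA.
apply/closure_normP => e e0; have [a [Aa pa]] := clA (e / M) (divr_gt0 e0 M0).
exists (T a); split; first by exists a.
by rewrite -raddfB (le_lt_trans (TM _))// mulrC -ltr_pdivlMr.
Qed.

Lemma bounded_comp (E F G : normedModType K) (S : {linear E -> F})
    (T : {linear F -> G}) :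
  bounded_operator S -> bounded_operator T ->
  bounded_operator (T \o S : {linear E -> G}).
Proof.
move=> [M SM] /bounded_operator_pos[N N0 TN]; exists (N * M) => x /=.
by rewrite (le_trans (TN _))// -mulrA ler_pM2l.
Qed.

Lemma bounded_add (E F : normedModType K) (S T : {linear E -> F}) :
  bounded_operator S -> bounded_operator T ->
  bounded_operator (S \+ T : {linear E -> F}).
Proof.
move=> [M SM] [N TN]; exists (M + N) => x /=.
by rewrite (le_trans (ler_normD _ _))// mulrDl lerD.
Qed.

Lemma bounded_scale (E F : normedModType K) (a : K) (T : {linear E -> F}) :
  bounded_operator T -> bounded_operator (a \*: T : {linear E -> F}).
Proof.
by move=> [M TM]; exists (`|a| * M) => x /=; rewrite normrZ -mulrA ler_wpM2l.
Qed.

Lemma small_eq0 (V : normedModType K) (x : V) :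
  (forall e, 0 < e -> `|x| < e) -> x = 0.
Proof.
move=> xe; apply/eqP/contraT; rewrite -normr_gt0 => /xe.
by rewrite ltxx.
Qed.

Lemma eq_closure (E G : normedModType K) (S T : {linear E -> G}) (A : set E) p :
  bounded_operator S -> bounded_operator T ->
  (forall x, A x -> S x = T x) -> closure A p -> S p = T p.
Proof.
move=> /bounded_operator_pos[M M0 SM] /bounded_operator_pos[N N0 TN] ST.
move=> /closure_normP pA; apply/eqP; rewrite -subr_eq0; apply/eqP.
apply: small_eq0 => e e0; have MN0 : 0 < M + N by rewrite addr_gt0.
have [a [Aa pa]] := pA _ (divr_gt0 e0 MN0).
have -> : S p - T p = S (p - a) - T (p - a).
  by rewrite (linearB S) (linearB T) (ST _ Aa) opprB addrA subrK.
rewrite (le_lt_trans (ler_normB _ _))//.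
rewrite (@le_lt_trans _ _ ((M + N) * `|p - a|))//; first by rewrite mulrDl lerD.
by rewrite mulrC -ltr_pdivlMr.
Qed.

(** Together with [weak_cvgP], this replaces the supremum of initial topologies by estimates on
    functionals. *)
Lemma weak_nbhs (E : normedModType K) (p : E) (f : dual E) e : 0 < e ->
  nbhs (p : weak_space E) [set x | `|sval f p - sval f x| < e].
Proof.
move=> e0.
have /(@cvg_sup E _ _ _ _ (nbhs_filter (p : weak_space E)))/(_ f) :
  (p : weak_space E) --> (p : weak_space E) by [].
apply.
apply: (@initial_continuous E K^o (sval f) p [set y | `|sval f p - y| < e]).
by apply/nbhs_ballP; exists e => //= y; rewrite -ball_normE.
Qed.

Lemma weak_cvgP (E : normedModType K) (G : set_system E) (t : E) : Filter G ->
  (forall (f : dual E) e, 0 < e -> G [set x | `|sval f t - sval f x| < e]) ->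
  G --> (t : weak_space E).
Proof.
move=> GG Gt.
apply/cvg_sup => f A /= [_ [[B Bo <-] Bt BA]]; rewrite nbhs_filterE.
have /nbhs_ballP[e /= e0 eB] : nbhs (sval f t : K^o) B by exact: open_nbhs_nbhs.
apply: filterS (Gt f e e0) => x /= ftx; apply/BA/eB.
by rewrite -ball_normE.
Qed.

End NormedModules.

(** * Weakly compact sets *)

Section WeakCompactness.
Context {K : numFieldType}.

Lemma weakly_compact_image (E F : normedModType K) (T : {linear E -> F})
    (A : set E) :
  bounded_operator T -> weakly_compact A -> weakly_compact (T @` A).
Proof.
move=> Tb; apply: (@continuous_compact (weak_space E) (weak_space F) T A).
apply: continuous_subspaceT => x; apply: weak_cvgP => [|f e e0].
  exact: (@fmap_filter (weak_space E) _ T _ (nbhs_filter (x : weak_space E))).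
pose fT : dual E := exist _ (sval f \o T : {linear E -> K^o})
  (bounded_comp Tb (svalP f)).
exact: (weak_nbhs x fT e0).
Qed.

(** Stands in for the Eberlein-Smulian theorem: no weakly convergent subsequence is extracted, only
    a cluster point approached on finitely many functionals at a time. *)
Lemma weak_cluster_seq (E : normedModType K) (A : set E) (x : nat -> E) :
  weakly_compact A -> (forall k, A (x k)) ->
  exists2 p, A p & forall (f : nat -> dual E) n N e, 0 < e ->
    exists2 k, (N <= k)%N &
      forall i, (i < n)%N -> `|sval (f i) p - sval (f i) (x k)| < e.
Proof.
move=> Ac Ax.
have [|p [Ap xp]] := Ac (x @ \oo) (fmap_proper_filter _ _).
  by exists 0 => // k _; exact: Ax.
exists p => // f n N e e0.
have pB : nbhs (p : weak_space E) [set y |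
    forall i, (i < n)%N -> `|sval (f i) p - sval (f i) y| < e].
  elim: n => [|n IHn]; first by apply: filterE => y i.
  apply: filterS (filterI IHn (weak_nbhs p (f n) e0)) => y [/= yi yn] i.
  by rewrite ltnS leq_eqVlt => /orP[/eqP->|/yi].
have xN : (x @ \oo) [set y | exists2 k, (N <= k)%N & y = x k].
  by exists N => // k /= Nk; exists k.
by have [_ [[k Nk ->] /= fk]] := xp _ _ xN pB; exists k.
Qed.

(** An ultrafilter on the set that does not converge weakly to [0] contains, for some [f] and [e],
    the finite set of the [a i] with [|f (a i)| >= e], and so converges to one of them. *)
Lemma weakly_compact_null_family (E : normedModType K) (I : Type) (a : I -> E) :
  (forall (f : dual E) e, 0 < e ->
    finite_set (a @` [set i | e <= `|sval f (a i)|])) ->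
  weakly_compact ([set 0] `|` range a).
Proof.
move=> afin; rewrite /weakly_compact compact_ultra => U UU UA.
have [U0|] := pselect (U --> (0 : weak_space E)).
  by exists 0; split=> //; left.
move=> /(contra_not (@weak_cvgP _ E U 0 _)).
move=> /existsNP[f] /existsNP[e] /not_implyP[e0 nU].
pose S := a @` [set i | e <= `|sval f (a i)|].
have US : U S.
  have [//|] := in_ultra_setVsetC [set x | `|sval f 0 - sval f x| < e] UU.
  move=> /(filterI UA); apply: filterS => _ [[->|[i _ <-]]] /=.
    by rewrite subrr normr0 e0.
  rewrite raddf0 sub0r normrN => /negP; rewrite -real_leNgt//; last first.
    by rewrite ger0_real// ltW.
  by exists i.
have := @finite_compact (weak_space E) _ (afin f e e0).
rewrite compact_ultra => /(_ U UU US)[p [[i _ <-] Up]].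
by exists (a i); split=> //; right; exists i.
Qed.

End WeakCompactness.

(** * Closed linear spans and weakly compact generation *)

Section ClosedSpan.
Context {K : numFieldType}.

Lemma linear_span_incl (V : lmodType K) (A : set V) : A `<=` linear_span A.
Proof.
move=> x Ax; exists 1%N, (fun=> 1), (fun=> x); split=> //.
by rewrite big_ord1 scale1r.
Qed.

Lemma linear_span0 (V : lmodType K) (A : set V) : linear_span A 0.
Proof.
exists 0%N, (fun=> 0), (fun=> 0); split; first by case.
by rewrite big_ord0.
Qed.

Lemma linear_spanP (V : lmodType K) (A : set V) (a : K) x y :
  linear_span A x -> linear_span A y -> linear_span A (a *: x + y).
Proof.
move=> [m [c [v [Av ->]]]] [n [d [w [Aw ->]]]]; exists (m + n)%N.
exists (fun i =>
  match fintype.split i with inl i => a * c i | inr i => d i end).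
exists (fun i => match fintype.split i with inl i => v i | inr i => w i end).
split=> [i|]; first by case: splitP.
rewrite big_split_ord /= scaler_sumr; congr (_ + _); apply: eq_bigr => i _.
  by rewrite -/(unsplit (inl i)) unsplitK scalerA.
by rewrite -/(unsplit (inr i)) unsplitK.
Qed.

Lemma linear_span_le (V : lmodType K) (A B : set V) :
  B 0 -> (forall a x y, B x -> B y -> B (a *: x + y)) -> A `<=` B ->
  linear_span A `<=` B.
Proof.
move=> B0 BP AB _ [n [c [v [Av ->]]]].
elim/big_rec: _ => // i x _ Bx; apply: BP => //; exact/AB.
Qed.

Lemma linear_span_image (V W : lmodType K) (T : {linear V -> W}) (A : set V) :
  T @` linear_span A `<=` linear_span (T @` A).
Proof.
move=> _ [_ [n [c [v [Av ->]]]] <-]; exists n, c, (T \o v); split=> [i|].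
  by exists (v i).
by rewrite linear_sum; apply: eq_bigr => i _; rewrite linearZ.
Qed.

Lemma linear_span_liftP (V W : lmodType K) (T : {linear V -> W}) (A : set V) w :
  linear_span (T @` A) w -> exists2 v, linear_span A v & T v = w.
Proof.
move: w; apply: linear_span_le.
- by exists 0; [exact: linear_span0|rewrite linear0].
- move=> a _ _ [x Ax <-] [y Ay <-].
  exists (a *: x + y); last by rewrite linearP.
  exact: linear_spanP.
- by move=> _ [v Av <-]; exists v => //; exact: linear_span_incl.
Qed.

Lemma closure_span_submod (V : normedModType K) (A : set V) :
  GRing.submod_closed [in closure (linear_span A)].
Proof.
split=> [|a x y /set_mem/closure_normP xA /set_mem/closure_normP yA].
  exact/mem_set/subset_closure/linear_span0.
apply/mem_set/closure_normP => e e0.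
(* [|a| + 1] rather than [|a|], to allow [a = 0]. *)
have a0 : 0 < `|a| + 1 by rewrite ltr_wpDl.
have e2 : 0 < e / 2 by rewrite divr_gt0.
have [x' [Ax' xx']] := xA (e / 2 / (`|a| + 1)) (divr_gt0 e2 a0).
have [y' [Ay' yy']] := yA (e / 2) e2.
exists (a *: x' + y'); split; first exact: linear_spanP.
rewrite opprD addrACA -scalerBr (le_lt_trans (ler_normD _ _))// [ltRHS]splitr.
rewrite ler_ltD// normrZ; move: xx'; rewrite ltr_pdivlMr// => /ltW.
by apply: le_trans; rewrite mulrC ler_wpM2l// lerDl.
Qed.

Definition closed_span (F : completeNormedModType K) (A : set F) :
    closed_subspace F :=
  ClosedSubspace (@closure_span_submod F A) (@closed_closure _ _).

Lemma closed_span_incl (F : completeNormedModType K) (A : set F) :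
  A `<=` closed_span A.
Proof. by move=> x Ax; apply/subset_closure/linear_span_incl. Qed.

Lemma csub_combination (F : completeNormedModType K) (Z : closed_subspace F)
  (a : K) x y :
  csub_set Z x -> csub_set Z y -> csub_set Z (a *: x + y).
Proof.
have [_ ZP] := csub_submod Z.
by move=> /mem_set Zx /mem_set Zy; exact/set_mem/ZP.
Qed.

Lemma csub0 (F : completeNormedModType K) (Z : closed_subspace F) :
  csub_set Z 0.
Proof. by have [Z0 _] := csub_submod Z; exact/set_mem. Qed.

Lemma closed_span_le (F : completeNormedModType K) (Z : closed_subspace F)
  (A : set F) : A `<=` Z -> closed_span A `<=` Z.
Proof.
move=> AZ; rewrite [X in _ `<=` X](closure_id _).1; last exact: csub_closed.
apply: closure_subset; apply: linear_span_le => //; first exact: csub0.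
by move=> a x y; exact: csub_combination.
Qed.

Lemma eq_closed_span (E : completeNormedModType K) (G : normedModType K)
    (S T : {linear E -> G}) (A : set E) p :
  bounded_operator S -> bounded_operator T ->
  (forall x, A x -> S x = T x) -> csub_set (closed_span A) p -> S p = T p.
Proof.
move=> Sb Tb ST; apply: eq_closure => // _ [n [c [v [Av ->]]]].
by rewrite !linear_sum; apply: eq_bigr => i _; rewrite !linearZ ST.
Qed.

Section Corestriction.
Variables (E : normedModType K) (F : completeNormedModType K).
Variables (T : {linear E -> F}) (Z : closed_subspace F) 
  (TZ : forall x, csub_set Z (T x)).

(** As a bounded operator into [csub Z], it carries weakly compact sets to sets weakly compact in
    the weak topology of [Z] itself, with no appeal to Hahn-Banach. *)
Definition corestriction x : csub Z := CSub (mem_set (TZ x)).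

Lemma corestriction_linear : linear corestriction.
Proof. by move=> a x y; apply/val_inj; rewrite /= linearP. Qed.

HB.instance Definition _ :=
  GRing.isLinear.Build K E (csub Z) _ corestriction corestriction_linear.

Lemma bounded_corestriction :
  bounded_operator T -> bounded_operator corestriction.
Proof. by move=> [M TM]; exists M => x; exact: TM. Qed.

End Corestriction.

Lemma bounded_inclusion (F : completeNormedModType K) (Z : closed_subspace F) :
  bounded_operator (inclusion Z).
Proof. by exists 1 => x; rewrite mul1r. Qed.

Lemma dense_closure (T : topologicalType) (A : set T) :
  dense A -> forall p, closure A p.
Proof.
move=> dA p B; rewrite nbhsE => -[C [Co Cp] CB].
have [x [Cx Ax]] := dA C (ex_intro _ p Cp) Co.
by exists x; split=> //; apply: CB.
Qed.

Lemma WCG_closed_span (F : completeNormedModType K) (B : set F)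
    (A : set (csub (closed_span B))) :
  weakly_compact A -> B `<=` inclusion _ @` A ->
  WCG_space (csub (closed_span B)).
Proof.
move=> Ac BA; exists A; split=> // O [p Op] Oo.
have /nbhs_ballP[e /= e0 eO] : nbhs p O by exact: open_nbhs_nbhs.
have /set_mem/closure_normP/(_ e e0)[b [Bb pb]] := csub_valP p.
have : linear_span (inclusion _ @` A) b.
  move: {pb} b Bb; apply: linear_span_le; first exact: linear_span0.
    by move=> a x y; exact: linear_spanP.
  by move=> x /BA; exact: linear_span_incl.
move=> /linear_span_liftP[q Aq qb]; exists q; split=> //.
by apply: eO; rewrite -ball_normE; move: pb; rewrite -qb.
Qed.

(** Moves a generating set of [E] into [F]; the image of a dense span is dense in the range of
    [T]. *)
Lemma WCG_space_closed_span (E F : completeNormedModType K)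
    (T : {linear E -> F}) :
  bounded_operator T -> WCG_space E ->
  exists A : set E, weakly_compact A /\ range T `<=` closed_span (T @` A).
Proof.
move=> Tb [A [Ac dA]]; exists A; split=> // _ [x _ <-].
have := closure_image Tb (dense_closure dA (p := x)).
exact/closure_subset/(linear_span_image (T := T)).
Qed.

End ClosedSpan.

(** * The ideal properties and surjectivity *)

Section OperatorIdeal.
Context {K : numFieldType}.

(** Finitely many generators form a compact set in any topology. *)
Lemma WCG_finite_rank (E F : completeNormedModType K) (T : {linear E -> F}) n
    (y : 'I_n -> F) :
  bounded_operator T -> range T `<=` linear_span (range y) -> WCG K E F T.
Proof.
move=> Tb Ty; split=> //; exists (closed_span (range y)); split; last first.
  by apply: subset_trans Ty _; exact: subset_closure.
apply: (@WCG_closed_span K F _ (inclusion _ @^-1` range y)); last first.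
  move=> x yx; have Zx := mem_set (closed_span_incl yx).
  by exists (CSub Zx).
apply: finite_compact; apply: finite_preimage; first by move=> ? ? _ _ /val_inj.
exact: finite_image.
Qed.

(** The image of [Z] under [U] need not be closed, so the closed span of the image of a generating
    set [A] is used instead. *)
Lemma WCG_comp (D E F G : completeNormedModType K)
    (S : {linear D -> E}) (T : {linear E -> F}) (U : {linear F -> G}) :
  bounded_operator S -> WCG K E F T -> bounded_operator U ->
  WCG K D G (U \o T \o S : {linear D -> G}).
Proof.
move=> Sb [Tb [Z [ZW TZ]]] Ub.
split; first exact: bounded_comp Sb (bounded_comp Tb Ub).
have UZb := bounded_comp (@bounded_inclusion _ _ Z) Ub.
have [A [Ac UA]] := WCG_space_closed_span UZb ZW.
have UA' x : csub_set (closed_span ((U \o inclusion Z) @` A))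
    ((U \o inclusion Z : {linear csub Z -> G}) x) by apply: UA; exists x.
exists (closed_span ((U \o inclusion Z) @` A)); split.
  apply: (WCG_closed_span (A := corestriction UA' @` A)).
    exact: weakly_compact_image (bounded_corestriction UA' UZb) Ac.
  by move=> _ [x Ax <-]; exists (corestriction UA' x) => //; exists x.
move=> _ [x _ <-]; have TSx : csub_set Z (T (S x)) by apply: TZ; exists (S x).
exact: (UA' (CSub (mem_set TSx))).
Qed.

(** [Y + Z] need not be closed; the closed span of the union [C] of the two generating sets contains
    both summands. *)
Lemma WCG_add (E F : completeNormedModType K) (S T : {linear E -> F}) :
  WCG K E F S -> WCG K E F T -> WCG K E F (S \+ T : {linear E -> F}).
Proof.
move=> [Sb [Y [YW SY]]] [Tb [Z [ZW TZ]]]; split; first exact: bounded_add.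
have [A [Ac YA]] := WCG_space_closed_span (@bounded_inclusion _ _ Y) YW.
have [B [Bc ZB]] := WCG_space_closed_span (@bounded_inclusion _ _ Z) ZW.
pose C := (inclusion Y @` A) `|` (inclusion Z @` B).
have span_mono (D : set F) : D `<=` C -> closed_span D `<=` closed_span C.
  move=> DC; apply: closed_span_le.
  exact: subset_trans DC (@closed_span_incl _ _ _).
have YC x : csub_set (closed_span C) (inclusion Y x).
  by apply: (span_mono (inclusion Y @` A)); [left|apply: YA; exists x].
have ZC x : csub_set (closed_span C) (inclusion Z x).
  by apply: (span_mono (inclusion Z @` B)); [right|apply: ZB; exists x].
exists (closed_span C); split.
  apply: (WCG_closed_span
    (A := (corestriction YC @` A) `|` (corestriction ZC @` B))).
    apply: compactU; apply: weakly_compact_image => //;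
      exact/bounded_corestriction/bounded_inclusion.
  move=> _ [[x Ax <-]|[x Bx <-]].
    by exists (corestriction YC x) => //; left; exists x.
  by exists (corestriction ZC x) => //; right; exists x.
move=> _ [x _ <-].
have Sx : csub_set Y (S x) by apply: SY; exists x.
have Tx : csub_set Z (T x) by apply: TZ; exists x.
have := csub_combination 1 (YC (CSub (mem_set Sx))) (ZC (CSub (mem_set Tx))).
by rewrite scale1r.
Qed.

Lemma WCG_operator_ideal : operator_ideal (WCG K).
Proof.
split=> [E F T []//|E F T n y|E F S T|E F a T [Tb [Z [ZW TZ]]]|D E F G S T U].
- exact: WCG_finite_rank.
- exact: WCG_add.
- split; first exact: bounded_scale.
  exists Z; split=> // _ [x _ <-].
  have Tx : csub_set Z (T x) by apply: TZ; exists x.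
  by have := csub_combination a Tx (csub0 Z); rewrite addr0.
- exact: WCG_comp.
Qed.

Lemma WCG_surjective : surjective_class (WCG K).
Proof.
move=> E E0 F Q T Qb Qsurj Tb [_ [Z [ZW TQZ]]]; split=> //.
exists Z; split=> // _ [x _ <-].
have [y _ <-] : range Q x by rewrite Qsurj.
by apply: TQZ; exists y.
Qed.

End OperatorIdeal.

(** * The Banach space of bounded functions under the supremum norm *)

Section BoundedFunctions.
Context {K : numFieldType}.

Definition bounded_function (L : Type) : {pred L -> K} :=
  fun x => `[< exists M, forall l, `|x l| <= M >].

Lemma bounded_function_submod (L : Type) :
  GRing.submod_closed (@bounded_function L).
Proof.
split=> [|a x y /asboolP[M xM] /asboolP[N yN]]; apply/asboolP.
  by exists 0 => l; rewrite normr0.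
exists (`|a| * M + N) => l; apply: le_trans (ler_normD _ _) _.
by rewrite lerD// normrM ler_wpM2l.
Qed.

HB.instance Definition _ (L : Type) :=
  GRing.isSubmodClosed.Build K (L -> K) (@bounded_function L)
    (@bounded_function_submod L).

(* The norm is a supremum in K, hence the dependence on [scalar_facts K]. *)
Record bfun (HK : scalar_facts K) (L : Type) :=
  BFun { bfun_val :> L -> K; bfun_valP : bfun_val \in @bounded_function L }.

Variables (HK : scalar_facts K) (L : Type).

HB.instance Definition _ := [isSub for @bfun_val HK L].
HB.instance Definition _ := [Choice of bfun HK L by <:].
HB.instance Definition _ := [SubChoice_isSubLmodule of bfun HK L by <:].

Lemma bfun_norm_ex (x : bfun HK L) :
  exists s, 0 <= s /\ (forall l, `|x l| <= s) /\
    (forall b, 0 <= b -> (forall l, `|x l| <= b) -> s <= b).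
Proof.
have /asboolP[M xM] := bfun_valP x.
(* Adding [0] makes the set nonempty even for empty [L], in which case [M] is also arbitrary, whence
   [|M|]. *)
have [||s [sub sle]] :=
    scalar_lub HK (A := [set a | a = 0 \/ exists l, a = `|x l|]) (M := `|M|).
- by exists 0; left.
- move=> a [->|[l ->]]; rewrite normr_ge0 ?lexx//=.
  rewrite (le_trans (xM _))// real_ler_norm// ger0_real//.
  exact: le_trans (normr_ge0 _) (xM l).
exists s; split; first by apply: sub; left.
split=> [l|b b0 xb]; first by apply: sub; right; exists l.
by apply: sle => a [->|[l ->]].
Qed.

Definition bfun_norm (x : bfun HK L) : K := sval (cid (bfun_norm_ex x)).

Lemma bfun_norm_ub (x : bfun HK L) l : `|x l| <= bfun_norm x.
Proof. by rewrite /bfun_norm; case: cid => s /= [_ [+ _]]; exact. Qed.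

Lemma bfun_norm_ge0 (x : bfun HK L) : 0 <= bfun_norm x.
Proof. by rewrite /bfun_norm; case: cid => s /= []. Qed.

Lemma bfun_norm_le (x : bfun HK L) b :
  0 <= b -> (forall l, `|x l| <= b) -> bfun_norm x <= b.
Proof. by rewrite /bfun_norm; case: cid => s /= [_ [_ +]]; exact. Qed.

Lemma bfun_normD (x y : bfun HK L) :
  bfun_norm (x + y) <= bfun_norm x + bfun_norm y.
Proof.
apply: bfun_norm_le => [|l]; first by rewrite addr_ge0 ?bfun_norm_ge0.
by apply: le_trans (ler_normD _ _) _; rewrite lerD ?bfun_norm_ub.
Qed.

Lemma bfun_normZ (a : K) (x : bfun HK L) :
  bfun_norm (a *: x) = `|a| * bfun_norm x.
Proof.
have le_Z b y : bfun_norm (b *: y) <= `|b| * bfun_norm y.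
  apply: bfun_norm_le => [|l]; first by rewrite mulr_ge0 ?bfun_norm_ge0.
  by rewrite normrM ler_wpM2l ?bfun_norm_ub.
apply/eqP; rewrite eq_le le_Z /=; have [->|a0] := eqVneq a 0.
  by rewrite normr0 mul0r bfun_norm_ge0.
rewrite -ler_pdivlMl ?normr_gt0// -normfV.
by apply: le_trans (le_Z _ _); rewrite scalerA mulVf// scale1r.
Qed.

Lemma bfun_norm0_eq0 (x : bfun HK L) : bfun_norm x = 0 -> x = 0.
Proof.
move=> x0; apply/val_inj/funext => l; apply/eqP.
by rewrite -normr_le0 -x0 bfun_norm_ub.
Qed.

HB.instance Definition _ :=
  Lmodule_isNormed.Build K (bfun HK L) bfun_normD bfun_normZ bfun_norm0_eq0.

Lemma bfun_ub (x : bfun HK L) l : `|x l| <= `|x|.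
Proof. exact: bfun_norm_ub. Qed.

Lemma bfun_le (x : bfun HK L) b :
  0 <= b -> (forall l, `|x l| <= b) -> `|x| <= b.
Proof. exact: bfun_norm_le. Qed.

Lemma bfun_complete (G : set_system (bfun HK L)) :
  ProperFilter G -> cauchy G -> cvg G.
Proof.
move=> GG /cauchyP Gc.
have {}Gc e : 0 < e -> exists z, G [set w | `|z - w| < e].
  by move=> /Gc[z Gz]; exists z; rewrite -ball_normE in Gz.
have lim_ex l : exists t, forall e, 0 < e -> G [set w | `|t - w l| < e].
  apply: (scalar_complete HK (G := (fun x : bfun HK L => x l) @ G)) => e.
  move=> /Gc[z Gz]; exists (z l); apply: (@filterS _ G _ _ _ _ Gz) => w /=.
  exact: le_lt_trans (bfun_ub (z - w) l).
pose f l := sval (cid (lim_ex l)).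
have fP l e : 0 < e -> G [set w : bfun HK L | `|f l - w l| < e].
  by move: e; rewrite /f; case: cid.
(* The intermediate [w] depends on [l] but the bound does not, so the pointwise limit [f] is a
   uniform one. *)
have near_f e z : 0 < e -> G [set w | `|z - w| < e] ->
    forall l, `|f l - z l| <= e + e.
  move=> e0 Gz l; have [w [/= fw zw]] := filter_ex (filterI (fP l e e0) Gz).
  rewrite -(subrKA (w l)) (le_trans (ler_normD _ _))// lerD ?(ltW fw)//.
  by rewrite distrC (le_trans (bfun_ub (z - w) l))// ltW.
have fb : f \in @bounded_function L.
  have [z Gz] := Gc 1 ltr01; apply/asboolP; exists (`|z| + (1 + 1)) => l.
  rewrite -(subrK (z l) (f l)) addrC (le_trans (ler_normD _ _))//.
  by rewrite lerD ?bfun_ub ?near_f.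
apply/cvg_ex; exists (BFun HK fb); apply/cvgrPdist_lt => e e0.
(* Two quarters go to [f - z] by [near_f], one to [z - w], and one is slack. *)
have e40 : 0 < e / 4 by rewrite divr_gt0.
have [z Gz] := Gc _ e40; near=> w.
have zw : `|z - w| < e / 4 by near: w.
have fz : `|BFun HK fb - z| <= e / 4 + e / 4.
  by apply: bfun_le => [|l]; [rewrite addr_ge0// ltW|exact: near_f].
rewrite -(subrKA z) (le_lt_trans (ler_normD _ _))//.
have -> : e = (e / 4 + e / 4 + e / 4) + e / 4 by field.
by rewrite ler_ltD// (le_trans fz)// lerDl ltW.
Unshelve. all: by end_near.
Qed.

HB.instance Definition _ := Uniform_isComplete.Build (bfun HK L) bfun_complete.

End BoundedFunctions.

(** * The gliding hump argument *)

Section GlidingHump.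
Context {K : numFieldType} (HK : scalar_facts K).

Definition below (S : nat -> bool) N i := S i && (i < N)%N.
Definition above (S : nat -> bool) N i := S i && (N <= i)%N.

(* The set functions [S |-> \sum_(i in S) z i] for z in l_1, axiomatized. *)
Record tail_measure (mu : (nat -> bool) -> K) : Prop := {
  measure_cut : forall S N, mu S = mu (below S N) + mu (above S N);
  measure_tail : forall e, 0 < e ->
    exists N, forall S, `|mu (above S N)| < e
}.

Lemma tail_measureB mu nu : tail_measure mu -> tail_measure nu ->
  tail_measure (fun S => mu S - nu S).
Proof.
move=> [mucut mutail] [nucut nutail]; split=> [S N|e e0].
  by rewrite (mucut S N) (nucut S N) opprD addrACA.
have e2 : 0 < e / 2 by rewrite divr_gt0.
have [N muN] := mutail _ e2; have [P nuP] := nutail _ e2.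
exists (maxn N P) => S.
have aboveE Q : (Q <= maxn N P)%N ->
    above S (maxn N P) = above (above S (maxn N P)) Q.
  move=> QNP; apply/funext => i; rewrite /above -andbA; congr (_ && _).
  by case: leqP => // NPi; rewrite (leq_trans QNP).
rewrite (le_lt_trans (ler_normB _ _))// [ltRHS]splitr ltrD//.
  by rewrite (aboveE N) ?leq_maxl.
by rewrite (aboveE P) ?leq_maxr.
Qed.

(** Both pieces of a cut of the empty set are empty. *)
Lemma measure_empty mu : tail_measure mu -> mu (fun=> false) = 0.
Proof.
move=> [/(_ (fun=> false) 0%N) /esym/eqP + _].
by rewrite -subr_eq0 addrK => /eqP.
Qed.

Lemma measure_below_le mu S N : tail_measure mu ->
  `|mu (below S N)| <= \sum_(i < N) `|mu (pred1 (i : nat))|.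
Proof.
move=> mum; elim: N => [|N IHN].
  rewrite big_ord0 (_ : below S 0 = fun=> false) ?measure_empty ?normr0//.
  by apply/funext => i; rewrite /below ltn0 andbF.
rewrite big_ord_recr /= (measure_cut mum _ N) (le_trans (ler_normD _ _))//.
have -> : below (below S N.+1) N = below S N.
  apply/funext => i; rewrite /below -andbA; congr (_ && _).
  by apply: andb_idl => /ltnW.
rewrite lerD//; have [SN|/negbTE SN] := boolP (S N).
  rewrite (_ : above _ _ = pred1 N)//; apply/funext => i.
  rewrite /above /below /= -andbA ltnS -eqn_leq.
  by case: eqVneq => [->|]; rewrite ?SN ?andbF.
rewrite (_ : above _ _ = fun=> false) ?measure_empty ?normr0//.
apply/funext => i; rewrite /above /below -andbA ltnS -eqn_leq.
by case: eqVneq => [->|]; rewrite ?SN ?andbF.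
Qed.

(* Gliding hump: were the atoms not small, pick measures [w] tending to 0 on
   each singleton, with large atoms at positions [nj] in successive blocks. On
   the set [S] of all [nj] they stay large, but a cluster point, vanishing on
   all singletons, vanishes on [S]. *)
Lemma uniformly_small_atoms (C : set ((nat -> bool) -> K)) (d : K) :
  (forall mu, C mu -> tail_measure mu) ->
  (forall x : nat -> (nat -> bool) -> K, (forall k, C (x k)) ->
    exists2 p, C p & forall (S : nat -> nat -> bool) n N e, 0 < e ->
      exists2 k, (N <= k)%N &
        forall i, (i < n)%N -> `|p (S i) - x k (S i)| < e) ->
  0 < d ->
  exists N, forall n, (N <= n)%N -> forall mu, C mu -> `|mu (pred1 n)| < d.
Proof.
move=> Cmeas Cclus d0; apply: contrapT => unif.
have /choice[nx nxP] N : exists nx : nat * ((nat -> bool) -> K),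
    [/\ (N <= nx.1)%N, C nx.2 & d <= `|nx.2 (pred1 nx.1)|].
  apply: contrapT => nnx; apply: unif; exists N => n Nn mu Cmu.
  apply: contrapT => /negP; rewrite -real_leNgt//; last exact: gtr0_real.
  by move=> dmu; apply: nnx; exists (n, mu).
pose at_ k := (nx k).1; pose x k := (nx k).2.
have [|p Cp px] := Cclus x; first by move=> k; have [] := nxP k.
pose w k S := x k S - p S.
have wm k : tail_measure (w k).
  by apply: tail_measureB; apply: Cmeas => //; have [] := nxP k.
(* Of [d = 8 h], the atom of [p] beyond [N0] costs [4 h], which leaves [4 h] for [w]; the parts of
   [S] below and above a block cost [h] each, which leaves [2 h] in [wS]. *)
pose h := d / 8.
have h0 : 0 < h by rewrite divr_gt0.
have [N0 pN0] := measure_tail (Cmeas _ Cp) (mulr_gt0 (ltr0n K 4) h0).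
have w_atom k : (N0 <= k)%N -> 4%:R * h <= `|w k (pred1 (at_ k))|.
  move=> N0k; have [kn _ dx] := nxP k.
  have pat : `|p (pred1 (at_ k))| < 4%:R * h.
    rewrite (_ : (pred1 _ : nat -> bool) = above (pred1 (at_ k)) N0)//.
    apply/funext => i; rewrite /above /=; case: eqVneq => // ->.
    by rewrite (leq_trans N0k).
  rewrite (le_trans _ (lerB_dist _ _))// lerBrDr (le_trans _ dx)//.
  by rewrite (_ : d = 4%:R * h + 4%:R * h) ?lerD2l ?ltW// /h; field.
(* One step of the construction: from the start [N] of a block, an index [kN.1] and the end [kN.2]
   of the block. The bound [h / N.+1] makes the total mass below [N] at most [h]. *)
have /choice[st stP] N : exists kN : nat * nat,
    [/\ (maxn N N0 <= kN.1)%N, (at_ kN.1 < kN.2)%N,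
      forall i, (i < N)%N -> `|w kN.1 (pred1 i)| <= h / N.+1%:R &
      forall S, `|w kN.1 (above S kN.2)| < h].
  have [k Nk wk] := px (fun i => pred1 i) N (maxn N N0) (h / N.+1%:R)
    (divr_gt0 h0 (ltr0Sn _ _)).
  have [P wP] := measure_tail (wm k) h0; exists (k, maxn P (at_ k).+1).
  split=> //=; [exact: leq_maxr|by move=> i /wk/ltW; rewrite distrC|].
  move=> S; rewrite (_ : above _ _ = above (above S (maxn P (at_ k).+1)) P)//.
  apply/funext => i; rewrite /above -andbA; congr (_ && _).
  by case: leqP => // Pi; rewrite (leq_trans (leq_maxl _ _) Pi).
pose fix_N j := iter j (fun N => (st N).2) 0%N.
pose kj j := (st (fix_N j)).1; pose nj j := at_ (kj j).
have nj_lt j : (nj j < fix_N j.+1)%N by have [] := stP (fix_N j).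
have nj_ge j : (fix_N j <= nj j)%N.
  have [Nk _ _ _] := stP (fix_N j); have [kn _ _] := nxP (kj j).
  by rewrite (leq_trans _ kn)// (leq_trans _ Nk)// leq_maxl.
have fixS j : (fix_N j < fix_N j.+1)%N := leq_ltn_trans (nj_ge j) (nj_lt j).
have fix_mono : {homo fix_N : i j / (i <= j)%N}.
  by apply: homo_leq => // [i j k|j]; [exact: leq_trans|exact/ltnW].
have fix_ge j : (j <= fix_N j)%N.
  by elim: j => // j IHj; rewrite (leq_ltn_trans IHj).
pose S i := `[< exists j, i = nj j >].
have S_block j : below (above S (fix_N j)) (fix_N j.+1) = pred1 (nj j).
  apply/funext => i; rewrite /below /above /=.
  apply/idP/eqP => [|->]; last first.
    by rewrite nj_lt nj_ge !andbT; apply/asboolP; exists j.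
  move=> /andP[/andP[/asboolP[l ->]] jl lj]; congr nj.
  apply/eqP; rewrite eqn_leq; apply/andP; split; rewrite leqNgt.
    apply: contraL lj => /fix_mono jl'.
    by rewrite -leqNgt (leq_trans jl').
  apply: contraL jl => /fix_mono lj'.
  by rewrite -ltnNge (leq_trans (nj_lt l)).
have wS j : 2%:R * h <= `|w (kj j) S|.
  have [Nk _ wlow wtail] := stP (fix_N j).
  have low : `|w (kj j) (below S (fix_N j))| <= h.
    apply: (le_trans (measure_below_le _ _ (wm _))).
    apply: (@le_trans _ _ (\sum_(i < fix_N j) h / (fix_N j).+1%:R)).
      by apply: ler_sum => i _; apply: wlow.
    rewrite sumr_const card_ord -[_ *+ fix_N j]mulr_natr mulrAC.
    rewrite ler_pdivrMr ?ltr0Sn//.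
    by rewrite ler_pM2l// ler_nat.
  have high : `|w (kj j) (above S (fix_N j.+1))| <= h by apply/ltW/wtail.
  rewrite (measure_cut (wm _) _ (fix_N j)).
  rewrite (measure_cut (wm _) (above S (fix_N j)) (fix_N j.+1)) S_block.
  have -> : above (above S (fix_N j)) (fix_N j.+1) = above S (fix_N j.+1).
    apply/funext => i; rewrite /above -andbA; congr (_ && _).
    by apply: andb_idl; apply: leq_trans; exact/ltnW.
  have atom : 4%:R * h <= `|w (kj j) (pred1 (nj j))|.
    by apply: w_atom; rewrite (leq_trans _ Nk)// leq_maxr.
  set a := w _ (below _ _) in low *; set c := w _ (above _ _) in high *.
  set b := w _ (pred1 _) in atom *.
  (* [a], [b] and [c] are the values of [w] on the parts of [S] before, inside and after block
     [j]. *)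
  have : `|b| <= `|a + (b + c)| + h + h.
    have -> : b = a + (b + c) - a - c by ring.
    rewrite (le_trans (ler_normB _ _))// lerD// (le_trans (ler_normB _ _))//.
    by rewrite lerD// (_ : a + _ - a - c = b)//; ring.
  move=> /(le_trans atom); rewrite -!lerBlDr; apply: le_trans.
  by rewrite (_ : _ - h - h = 2%:R * h)//; ring.
(* [p] need not be a cluster point of the chosen subsequence, so a second cluster point [q] is
   taken. It agrees with [p] on singletons, hence on [S] by the tail condition, while [x (kj j) S]
   comes within [h] of [q S], against [wS]. *)
have [j|q Cq qx] := Cclus (fun j => x (kj j)); first by have [] := nxP (kj j).
have um : tail_measure (fun S => q S - p S).
  by apply: tail_measureB; exact: Cmeas.
have u_atom i : q (pred1 i) - p (pred1 i) = 0.
  apply: small_eq0 => e e0; have e2 : 0 < e / 2 by rewrite divr_gt0.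
  have [J hJ] := archi_lt HK (ltW h0) e2.
  have [j Jj qj] := qx (fun=> pred1 i) 1%N (maxn J i.+1) _ e2.
  have [_ _ wlow _] := stP (fix_N j).
  have Jif : (maxn J i.+1 <= fix_N j)%N := leq_trans Jj (fix_ge j).
  rewrite -(subrKA (x (kj j) (pred1 i))) (le_lt_trans (ler_normD _ _))//.
  rewrite [ltRHS]splitr ltrD ?(qj 0%N)//.
  apply: (le_lt_trans (wlow i _)).
    by rewrite (leq_trans _ Jif)// leq_maxr.
  by apply: hJ; rewrite (leq_trans _ Jif)// leq_maxl.
have uS : q S - p S = 0.
  apply: small_eq0 => e e0; have [N uN] := measure_tail um e0.
  rewrite (measure_cut um S N) (_ : q (below _ _) - _ = 0) ?add0r//.
  apply/eqP; rewrite -normr_le0 (le_trans (measure_below_le S N um))//.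
  by rewrite big1// => i _; rewrite u_atom normr0.
have [j _ /(_ 0%N isT) qj] := qx (fun=> S) 1%N 0%N _ h0.
have : `|w (kj j) S| < 2%:R * h.
  rewrite /w -(subrKA (q S)) uS addr0 distrC (lt_trans qj)//.
  by rewrite ltr_pMl// ltr1n.
by move=> /lt_le_trans/(_ (wS j)); rewrite ltxx.
Qed.

End GlidingHump.

(** * The ambient space and its weakly compact generating set *)

Section AmbientSpace.
Context {K : numFieldType} (HK : scalar_facts K).

(* A selection picks at most one branch at each level. *)
Definition branch := nat -> nat.
Definition selection := nat -> option branch.
Notation F := (bfun HK selection).

Definition eval_at (l : selection) (x : F) : K^o := x l.

Lemma eval_at_linear l : linear (eval_at l).
Proof. by []. Qed.

HB.instance Definition _ l :=
  GRing.isLinear.Build K F K^o _ (eval_at l) (eval_at_linear l).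

Lemma bounded_eval_at l : bounded_operator (eval_at l : {linear F -> K^o}).
Proof. by exists 1 => x; rewrite mul1r bfun_ub. Qed.

Definition eval_dual l : dual F := exist _ _ (bounded_eval_at l).

Definition indicator (n : nat) (g : branch) (l : selection) : K :=
  (`[< l n = Some g >])%:R.

Lemma indicator_le1 n g l : `|indicator n g l| <= 1.
Proof. by rewrite /indicator; case: asbool; rewrite ?normr1 ?normr0. Qed.

Lemma indicator_bounded n g : indicator n g \in @bounded_function K selection.
Proof. by apply/asboolP; exists 1 => l; exact: indicator_le1. Qed.

Definition unit_vec n g : F := BFun HK (indicator_bounded n g).

(** At most one term is nonzero, since [l] selects at most one branch at level [n]. *)
Lemma sum_indicator_le1 n (s : seq branch) (c : branch -> K) l :
  uniq s -> (forall g, `|c g| <= 1) ->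
  `|\sum_(g <- s) c g * indicator n g l| <= 1.
Proof.
move=> us c1; case ln: (l n) => [g0|]; last first.
  rewrite big1 ?normr0// => g _; rewrite /indicator ln.
  by rewrite asboolF ?mulr0.
have [g0s|g0s] := boolP (g0 \in s).
  rewrite (bigD1_seq g0)//= big1 ?addr0 => [|g gg0].
    rewrite normrM.
    by rewrite (le_trans (ler_pM _ _ (c1 g0) (indicator_le1 n g0 l))) ?mulr1.
  by rewrite /indicator ln asboolF ?mulr0// => -[] g0g; rewrite g0g eqxx in gg0.
rewrite big_seq big1 ?normr0// => g gs; rewrite /indicator ln.
by rewrite asboolF ?mulr0// => -[] g0g; rewrite g0g gs in g0s.
Qed.

(** The scaling leaves the closed span unchanged and makes every functional tend to [0] along the
    levels. *)
Definition gen (p : nat * branch) : F := p.1.+1%:R^-1 *: unit_vec p.1 p.2.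

Definition ambient : closed_subspace F := closed_span (range gen).

Lemma ambient_gen p : csub_set ambient (gen p).
Proof. by apply: closed_span_incl; exists p. Qed.

Definition ambient_gen_csub p : csub ambient := CSub (mem_set (@ambient_gen p)).

(* The unit vectors of one level span a copy of c_0, so a functional is
   absolutely summable over them. *)
Lemma dual_level_finite (f : dual (csub ambient)) n e : 0 < e ->
  finite_set [set g | e <= `|sval f (ambient_gen_csub (n, g))|].
Proof.
move=> e0; apply: contrapT => infS.
have [M M0 fM] := bounded_operator_pos (svalP f).
have [N MN] := scalar_archi HK (divr_ge0 (ltW M0) (ltW e0)).
have [B BS NB] := infinite_set_fset N infS.
pose s : seq branch := finmap.enum_fset B.
(* The phase [c g] turns [y g] into [|y g|]; it is [0] if [y g = 0], by the convention for division
   by zero. Then [x] has norm at most [1], but [f x] is at least [N * e > M]. *)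
pose y g := sval f (ambient_gen_csub (n, g)); pose c g := `|y g| / y g.
pose x := \sum_(g <- s) c g *: ambient_gen_csub (n, g).
have c1 g : `|c g| <= 1.
  rewrite /c normrM normr_id normfV.
  by have [->|nz] := eqVneq `|y g| 0; [rewrite mul0r|rewrite divff].
have x1 : `|x| <= 1.
  rewrite -[leLHS]/(`|inclusion ambient x|).
  have -> : inclusion ambient x = \sum_(g <- s) c g *: gen (n, g).
    by rewrite /x linear_sum; apply: eq_bigr => g _; rewrite linearZ.
  apply: bfun_le => // l.
  have -> : (\sum_(g <- s) c g *: gen (n, g)) l =
      n.+1%:R^-1 * \sum_(g <- s) c g * indicator n g l.
    rewrite -[LHS]/(eval_at l _) linear_sum mulr_sumr; apply: eq_bigr => g _.
    by rewrite linearZ /eval_at /= /GRing.scale /= mulrCA.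
  rewrite normrM normfV normr_nat -[leRHS]mul1r ler_pM//.
    by rewrite invf_le1 ?ler1n ?ltr0n.
  exact: sum_indicator_le1 (finmap.fset_uniq B) c1.
have fx : N%:R * e <= `|sval f x|.
  have -> : sval f x = \sum_(g <- s) `|sval f (ambient_gen_csub (n, g))|.
    rewrite linear_sum; apply: eq_big_seq => g /BS /= eg.
    rewrite linearZ /c /y /= /GRing.scale /= divfK//.
    by rewrite -normr_gt0 (lt_le_trans e0).
  rewrite ger0_norm ?sumr_ge0//.
  apply: (@le_trans _ _ (\sum_(g <- s) e)).
    rewrite big_const_seq count_predT iter_addr_0 -[e *+ _]mulr_natl.
    by rewrite ler_pM2r// ler_nat.
  by rewrite big_seq [leRHS]big_seq; apply: ler_sum => g /BS.
have : N%:R * e <= M.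
  by rewrite (le_trans fx)// (le_trans (fM x))// ler_piMr// ltW.
by rewrite -ler_pdivlMr// => /(lt_le_trans MN); rewrite ltxx.
Qed.

(** A functional of bound [M] is at most [M / (n + 1)] on level [n], so only finitely many levels
    reach [e], each at finitely many branches by [dual_level_finite]. *)
Lemma ambient_WCG : WCG_space (csub ambient).
Proof.
apply: (WCG_closed_span (A := [set 0] `|` range ambient_gen_csub)); last first.
  by move=> _ [p _ <-]; exists (ambient_gen_csub p) => //; right; exists p.
apply: weakly_compact_null_family => f e e0; apply: finite_image.
have [M M0 fM] := bounded_operator_pos (svalP f).
have [N MN] := archi_lt HK (ltW M0) e0.
apply: (@sub_finite_set _ _ (\bigcup_(n in `I_N)
  (pair n @` [set g | e <= `|sval f (ambient_gen_csub (n, g))|]))).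
  move=> [n g] /= eg; exists n => /=; last by exists g.
  rewrite ltnNge; apply/negP => /MN.
  suff /(le_trans eg)/le_lt_trans/[apply] :
    `|sval f (ambient_gen_csub (n, g))| <= M / n.+1%:R by rewrite ltxx.
  rewrite (le_trans (fM _))// ler_pM2l// -[leLHS]/(`|gen (n, g)|).
  rewrite /gen normrZ normfV normr_nat -[leRHS]mulr1 ler_pM2l ?invr_gt0//.
  exact/bfun_le/indicator_le1.
apply: bigcup_finite => [|n _]; first exact: finite_II.
exact/finite_image/dual_level_finite.
Qed.

End AmbientSpace.

(** * Uniform decay of coordinates on weakly compact sets *)

Section NonHereditary.
Context {K : numFieldType} (HK : scalar_facts K).
Notation F := (bfun HK selection).
Notation gen := (gen HK).
Notation ambient := (ambient HK).
Notation eval_at := (@eval_at K HK).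

(** Evaluating an element of [ambient] here sums its coordinates at [(n, g n)] over [n] in [S]. *)
Definition sel (g : nat -> branch) (S : nat -> bool) : selection :=
  fun i => if S i then Some (g i) else None.

Lemma gen_eval p l : gen p l = p.1.+1%:R^-1 * indicator p.1 p.2 l.
Proof. by []. Qed.

(** Additivity holds on generators and passes to their closed span. For the tail, [z] is within [e]
    of a finite combination [s] of generators, which sees only finitely many levels. *)
Lemma ambient_tail_measure (g : nat -> branch) z :
  csub_set ambient z -> tail_measure (fun S => z (sel g S)).
Proof.
move=> Zz; split=> [S N|e e0].
  pose T : {linear F -> K^o} :=
    eval_at (sel g (below S N)) \+ eval_at (sel g (above S N)).
  apply: (eq_closed_span (S := eval_at (sel g S)) (T := T) _ _ _ Zz).
  - exact: bounded_eval_at.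
  - by apply: bounded_add; exact: bounded_eval_at.
  - move=> _ [[n h] _ <-].
    rewrite -[LHS]/(gen (n, h) (sel g S)).
    rewrite -[RHS]/(gen (n, h) (sel g (below S N)) +
                    gen (n, h) (sel g (above S N))).
    rewrite !gen_eval /= -mulrDr; congr (_ * _).
    rewrite /indicator /sel /below /above /=.
    have noneF : `[< None = Some h >] = false by exact: asboolF.
    by case: ltnP; rewrite ?andbT ?andbF noneF ?addr0 ?add0r.
move/closure_normP: Zz => /(_ e e0)[s [As zs]].
have [N sN] : exists N, forall S, s (sel g (above S N)) = 0.
  pose B : set F := [set s | exists N, forall l : selection,
    (forall i, (i < N)%N -> l i = None) -> s l = 0].
  have [N sN] : B s.
    apply: linear_span_le As.
    - by exists 0%N.
    - move=> a x y [N xN] [P yP]; exists (maxn N P) => l l0.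
      have -> : (a *: x + y) l = a * x l + y l by [].
      rewrite xN ?yP ?mulr0 ?addr0// => i iNP; apply: l0;
        by rewrite leq_max iNP ?orbT.
    - move=> _ [[n h] _ <-]; exists n.+1 => l l0.
      by rewrite gen_eval /indicator /= l0// asboolF ?mulr0.
  exists N => S; apply: sN => i iN; rewrite /sel /above leqNgt iN andbF//.
exists N => S; rewrite -[z _]subr0 -(sN S).
exact: le_lt_trans (bfun_ub (z - s) _) zs.
Qed.

Definition single n (g : branch) : selection := sel (fun=> g) (pred1 n).

(* Uniformity in [g] comes from selecting at each level a worst branch. *)
Lemma weakly_compact_small (A : set F) d :
  weakly_compact A -> A `<=` ambient -> 0 < d ->
  exists N, forall n, (N <= n)%N -> forall g x, A x -> `|x (single n g)| < d.
Proof.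
move=> Ac AZ d0.
have /choice[g gP] n : exists g0 : branch, forall g x, A x ->
    d <= `|x (single n g)| -> exists2 y, A y & d <= `|y (single n g0)|.
  have [[g0 [y [Ay dy]]]|no] :=
      pselect (exists g0 y, A y /\ d <= `|y (single n g0)|).
    by exists g0 => *; exists y.
  by exists (fun=> 0%N) => g x Ax dx; exfalso; apply: no; exists g, x.
pose C := [set mu | exists2 x, A x & mu = fun S => x (sel g S)].
have [||N NC] := uniformly_small_atoms HK (C := C) _ _ d0.
- by move=> _ [x Ax ->]; exact/ambient_tail_measure/AZ.
- move=> mu /(_ _)/cid2-/all_sig2[x Ax muE].
  have [p Ap px] := weak_cluster_seq Ac Ax.
  exists (fun S => p (sel g S)); first by exists p.
  move=> S n N e e0.
  have [k Nk pk] := px (fun i => eval_dual HK (sel g (S i))) n N e e0.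
  by exists k => // i /pk; rewrite muE.
exists N => n Nn h x Ax; have dr : d \is Num.real by exact: gtr0_real.
rewrite real_ltNge//; apply/negP => /(gP n h x Ax)[y Ay].
have /(NC n Nn) : C (fun S => y (sel g S)) by exists y.
rewrite (_ : sel g _ = single n (g n)); last first.
  by apply/funext => i; rewrite /single /sel /=; case: eqVneq => // ->.
by move=> /lt_le_trans h1 /h1; rewrite ltxx.
Qed.

End NonHereditary.

(** * The closed subspace that is not WCG *)

Section Counterexample.
Context {K : numFieldType} (HK : scalar_facts K).
Notation F := (bfun HK selection).
Notation gen := (gen HK).
Notation ambient := (ambient HK).
Notation eval_at := (@eval_at K HK).

Lemma geometric_eq0 (x : K) m :
  (forall N, (m <= N)%N -> `|x| <= 2%:R / 2%:R ^+ N) -> x = 0.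
Proof.
move=> xN; apply: small_eq0 => e e0.
have [n ne] := archi_lt HK (ler0n K 2) e0.
apply: le_lt_trans (xN (maxn m n) (leq_maxl _ _)) _.
apply: le_lt_trans (ne (maxn m n) (leq_maxr _ _)).
by rewrite ler_pM2l// lef_pV2 ?posrE ?exprn_gt0// -natrX ler_nat ltn_expl.
Qed.

(** The sum is the supremum of the partial sums, and [2 / 2 ^ N] is the tail of the geometric series
    from [N] on. *)
Lemma geometric_sum_ex (c : nat -> K) :
  (forall m, 0 <= c m <= (2%:R ^+ m)^-1) ->
  exists s, forall N, `|s - \sum_(m < N) c m| <= 2%:R / 2%:R ^+ N.
Proof.
move=> cb; pose S N := \sum_(m < N) c m.
have c0 m : 0 <= c m by case/andP: (cb m).
have pow0 N : 0 <= 2%:R / 2%:R ^+ N :> K by rewrite divr_ge0// exprn_ge0.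
have S_mono N M : (N <= M)%N -> S N <= S M.
  move=> /subnK<-; elim: (M - N)%N => // d IHd; rewrite addSn.
  by rewrite (le_trans IHd)// /S big_ord_recr/= lerDl.
have S_le N M : S M <= S N + 2%:R / 2%:R ^+ N.
  have [MN|/ltnW NM] := leqP M N.
    by rewrite (le_trans (S_mono _ _ MN))// lerDl.
  rewrite -(subnK NM); set d := (M - N)%N.
  (* Subtracting the remaining tail strengthens the bound so that the induction on [d]
     telescopes. *)
  apply: (@le_trans _ _ (S N + 2%:R / 2%:R ^+ N - 2%:R / 2%:R ^+ (d + N))).
    elim: d => [|d IHd]; first by rewrite addrK.
    rewrite addSn /S big_ord_recr /= -/(S _).
    have /andP[_ cd] := cb (d + N)%N.
    have telescope : (2%:R ^+ (d + N))^-1 =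
        2%:R / 2%:R ^+ (d + N) - 2%:R / 2%:R ^+ (d + N).+1 :> K.
      have : 2%:R ^+ (d + N) != 0 :> K by rewrite expf_neq0.
      by rewrite exprS; move: (2%:R ^+ (d + N)) => t t0; field.
    by rewrite telescope in cd; rewrite (le_trans (lerD IHd cd))// addrA subrK.
  by rewrite gerBl.
have [||s [sub sle]] :=
    scalar_lub HK (A := range S) (M := S 0%N + 2%:R / 2%:R ^+ 0).
- by exists (S 0%N); exists 0%N.
- by move=> _ [N _ <-]; rewrite S_le andbT; apply: sumr_ge0.
exists s => N; rewrite ger0_norm; last by rewrite subr_ge0 sub//; exists N.
by rewrite lerBlDl; apply: sle => _ [M _ <-]; exact: S_le.
Qed.

(* The vector is [\sum_m 2 ^- m *: unit_vec (g m) g]. *)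
Lemma branch_vec (g : branch) : injective g ->
  exists x : F, [/\ csub_set ambient x,
    forall m, x (single (g m) g) = (2%:R ^+ m)^-1 &
    forall n h, h <> g -> x (single n h) = 0].
Proof.
move=> ginj.
pose c l m : K := (2%:R ^+ m)^-1 * indicator (g m) g l.
have cb l m : 0 <= c l m <= (2%:R ^+ m)^-1.
  have p0 : 0 <= (2%:R ^+ m)^-1 :> K by rewrite invr_ge0 exprn_ge0.
  by rewrite /c /indicator; case: asbool; rewrite ?mulr1 ?mulr0 lexx p0.
have /choice[f fN] l := geometric_sum_ex (cb l).
have fb : f \in @bounded_function K selection.
  by apply/asboolP; exists (2%:R / 2%:R ^+ 0) => l;
    have := fN l 0%N; rewrite big_ord0 subr0.
exists (BFun HK fb); split=> [|m|n h hg].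
- rewrite [csub_set _](closure_id _).1; last exact: csub_closed.
  apply/closure_normP => e e0.
  have [n ne] := archi_lt HK (ler0n K 2) e0.
  pose s : F := \sum_(m < n) (2%:R ^+ m)^-1 *: unit_vec HK (g m) g.
  exists s; split.
    rewrite /s; elim/big_rec: _ => [|i y _ Zy]; first exact: csub0.
    apply: csub_combination Zy.
    have := csub_combination (g i).+1%:R (@ambient_gen _ HK (g i, g))
      (csub0 ambient).
    by rewrite addr0 /gen scalerA mulfV ?scale1r ?pnatr_eq0.
  apply: le_lt_trans (ne n (leqnn n)).
  apply: (@le_trans _ _ (2%:R / 2%:R ^+ n)); last first.
    by rewrite ler_pM2l// lef_pV2 ?posrE ?exprn_gt0// -natrX ler_nat ltn_expl.
  apply: bfun_le => [|l]; first by rewrite divr_ge0// exprn_ge0.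
  have sl : s l = \sum_(m < n) c l m.
    rewrite -[LHS]/(eval_at l s) /s linear_sum; apply: eq_bigr => i _.
    by rewrite linearZ.
  by rewrite -[X in `|X|]/(f l - s l) sl.
- apply/eqP; rewrite -subr_eq0; apply/eqP/(@geometric_eq0 _ m.+1) => N mN.
  (* As [g] is injective, only the term [m] sees level [g m]. *)
  suff -> : (2%:R ^+ m)^-1 = \sum_(i < N) c (single (g m) g) i by exact: fN.
  rewrite (bigD1 (Ordinal mN)) //= big1 ?addr0 => [|i im].
    by rewrite /c /indicator /single /sel /= eqxx asboolT ?mulr1.
  rewrite /c /indicator /single /sel /=; case: eqVneq => [/ginj gim|_].
    by move: im; rewrite -val_eqE /= gim eqxx.
  by rewrite asboolF ?mulr0.
- apply/(@geometric_eq0 _ 0) => N _; rewrite -[BFun _ _ _]subr0.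
  suff : 0 = \sum_(i < N) c (single n h) i by move=> ->; exact: fN.
  rewrite big1// => i _; rewrite /c /indicator /single /sel /=.
  by rewrite asboolF ?mulr0//; case: ifP => // _ [].
Qed.

Definition nonWCG_set : set F := [set x | csub_set ambient x /\
  forall g m, x (single (g m) g) = 2%:R * x (single (g m.+1) g)].

Lemma nonWCG_submod : GRing.submod_closed [in nonWCG_set].
Proof.
split=> [|a x y /set_mem[Zx xg] /set_mem[Zy yg]]; apply/mem_set; split.
- exact: csub0.
- by move=> g m; rewrite mulr0.
- exact: csub_combination.
- move=> g m; rewrite -![(a *: x + y) _]/(a * x _ + y _) xg yg; ring.
Qed.

Lemma nonWCG_closed : closed nonWCG_set.
Proof.
move=> p pc; split=> [|g m].
  rewrite [csub_set _](closure_id _).1; last exact: csub_closed.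
  by apply: closure_subset pc => x [].
pose T : {linear F -> K^o} := 2%:R \*: eval_at (single (g m.+1) g).
apply: (eq_closure (S := eval_at (single (g m) g)) (T := T) _ _ _ pc).
- exact: bounded_eval_at.
- exact/bounded_scale/bounded_eval_at.
- by move=> x [_ /(_ g m)].
Qed.

Definition nonWCG_space : closed_subspace F :=
  ClosedSubspace nonWCG_submod nonWCG_closed.

Lemma nonWCG_not_spanned (A : set F) :
  weakly_compact A -> A `<=` nonWCG_set -> ~ nonWCG_set `<=` closed_span A.
Proof.
move=> Ac AX XA.
have AZ : A `<=` ambient by move=> x /AX[].
have p0 k : 0 < 2%:R ^+ k :> K by exact: exprn_gt0.
(* The threshold is [4 ^- m], to beat the decay [2 ^- m] that the relations impose. *)
have /choice[N NP] m := weakly_compact_small Ac AZ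
  (divr_gt0 ltr01 (mulr_gt0 (p0 m) (p0 m))).
(* Partial sums of [N i + 1] are strictly increasing and dominate [N]. The sequence of levels serves
   as its own branch label, so the relations along [g] concern exactly these levels. *)
pose g : branch := fun m => (\sum_(i < m.+1) (N i).+1)%N.
have gS m : (g m < g m.+1)%N.
  by rewrite /g [ltnRHS]big_ord_recr /= addnS ltnS leq_addr.
have gN m : (N m <= g m)%N.
  by rewrite /g big_ord_recr /= addnS leqW// leq_addl.
have ginj : injective g.
  by apply: incn_inj; apply: leq_mono; apply: homo_ltn => //; exact: ltn_trans.
have [x [Zx xg x0]] := branch_vec ginj.
have Xx : nonWCG_set x.
  split=> // h m; have [->|hg] := pselect (h = g); last by rewrite !x0// mulr0.
  by rewrite !xg exprS invfM mulrA mulfV ?mul1r.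
(* Otherwise this evaluation would vanish on the closed span of [A], which contains [x], where it
   equals [1]. *)
have [y Ay y0] : exists2 y, A y & y (single (g 0%N) g) <> 0.
  apply: contrapT => no.
  suff : x (single (g 0%N) g) = 0.
    by rewrite xg expr0 invr1 => /eqP; rewrite oner_eq0.
  apply: (eq_closed_span (S := eval_at (single (g 0%N) g)) (T := \0)
    _ _ _ (XA _ Xx)).
  - exact: bounded_eval_at.
  - by exists 0 => z; rewrite normr0 mul0r.
  - by move=> z Az; apply: contrapT => z0; apply: no; exists z.
have yg m : y (single (g 0%N) g) = 2%:R ^+ m * y (single (g m) g).
  elim: m => [|m ->]; first by rewrite expr0 mul1r.
  by have [_ ->] := AX _ Ay; rewrite exprSr mulrA.
have c0 : 0 < `|y (single (g 0%N) g)| by rewrite normr_gt0; exact/eqP.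
have [n ne] := archi_lt HK ler01 c0.
have : `|y (single (g 0%N) g)| < (2%:R ^+ n)^-1.
  rewrite (yg n) normrM (ger0_norm (ltW (p0 n))) mulrC -ltr_pdivlMr//.
  by rewrite -invfM -[ltRHS]div1r; exact: NP.
suff /lt_le_trans/[apply] : (2%:R ^+ n)^-1 <= 1 / n.+1%:R :> K.
  by move=> /(lt_trans (ne n (leqnn n))); rewrite ltxx.
by rewrite div1r lef_pV2 ?posrE// -natrX ler_nat ltn_expl.
Qed.

End Counterexample.

(** * Failure of injectivity *)

(** Injectivity is tested on the identity of [X]: followed by the inclusion, its range lies in the
    WCG space [ambient]. *)
Lemma WCG_not_injective (K : numFieldType) :
  scalar_facts K -> ~ injective_class (WCG K).
Proof.
move=> HK injK; pose X := nonWCG_space HK.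
have idb : bounded_operator (idfun : {linear csub X -> csub X}).
  by exists 1 => x; rewrite mul1r.
have [_ [W [WW XW]]] : WCG K (csub X) (csub X) idfun.
  apply: injK => //; split; first exact: bounded_inclusion.
  exists (ambient HK); split; first exact: ambient_WCG.
  by move=> _ [x _ <-]; have [] := set_mem (csub_valP x).
(* [W] is all of [X], being a subspace of it that contains the range of the identity; the two
   inclusions move its generating set into the space of bounded functions. *)
have jb := bounded_comp (@bounded_inclusion _ _ W) (@bounded_inclusion _ _ X).
have [A [Ac jA]] := WCG_space_closed_span jb WW.
apply: (nonWCG_not_spanned (weakly_compact_image jb Ac)).
  by move=> _ [x _ <-]; exact: set_mem (csub_valP (inclusion W x)).
move=> x Xx; have Xx' : x \in csub_pred X by exact: mem_set.
have Wx : CSub Xx' \in csub_pred W by apply/mem_set/XW; exists (CSub Xx').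
by apply: jA; exists (CSub Wx).
Qed.

Theorem proposition2p3 (R : realType) (K : numFieldType)
    (scalarK : real_or_complex R K) :
  [/\ operator_ideal (WCG K), surjective_class (WCG K)
    & ~ injective_class (WCG K)].
Proof.
split; first exact: WCG_operator_ideal.
- exact: WCG_surjective.
- exact/WCG_not_injective/(real_or_complex_facts scalarK).
Qed.
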